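(* Let $f\in\mathcal{H}_{\boldsymbol d}[m]$ be such that $\mathcal{M}_{\mathbb{S}}\ne\emptyset$ and $Df(x)$ is surjective for every $x\in\mathcal{M}_{\mathbb{S}}$. Then $$\tau(f)\ \ge\ \frac{1}{87\,\Gamma(f)}.$$
   Context: Let $1\le m\le n$, $\boldsymbol d=(d_1,\dots,d_m)$ integers with $d_i\ge2$. $\mathcal{H}_{\boldsymbol d}[m]$ is the space of systems $f=(f_1,\dots,f_m)$ with $f_i\in\mathbb{R}[X_0,\dots,X_n]$ homogeneous of degree $d_i$. $\mathbb{S}^n\subset\mathbb{R}^{n+1}$ is the unit sphere and $\mathcal{M}_{\mathbb{S}}=\{x\in\mathbb{S}^n\mid f(x)=0\}$, which under the stated hypotheses is a compact smooth submanifold of $\mathbb{R}^{n+1}$ of dimension $n-m$. For $x\in\mathbb{R}^{n+1}$ with $Df(x):\mathbb{R}^{n+1}\to\mathbb{R}^m$ surjective, $Df(x)^\dagger=Df(x)^t(Df(x)Df(x)^t)^{-1}$ and $$\gamma(f,x)=\max_{k>1}\Big\|Df(x)^\dagger\frac{D^kf(x)}{k!}\Big\|^{\frac1{k-1}}$$ (operator norm of $k$-linear maps, Euclidean norms). Set $\Gamma(f)=\max_{x\in\mathcal{M}_{\mathbb{S}}}\max\{1,\gamma(f,x)\}$. For a compact submanifold $\mathcal{M}\subset\mathbb{R}^{n+1}$, $\tau(\mathcal{M})$ (the injectivity radius of its normal bundle) is the largest $t$ such that the map $\{(x,v)\mid x\in\mathcal{M},\ v\in N_x\mathcal{M},\ \|v\|<t\}\to\mathbb{R}^{n+1}$,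 $(x,v)\mapsto x+v$, is injective, where $N_x\mathcal{M}$ is the orthogonal complement in $\mathbb{R}^{n+1}$ of the tangent space of $\mathcal{M}$ at $x$. Set $\tau(f)=\tau(\mathcal{M}_{\mathbb{S}})$. *)

(* Defs.v *)
From HB Require Import structures.
From mathcomp Require Import all_boot all_order all_algebra.
From mathcomp Require Import all_classical all_reals all_analysis.
(* The notations of [mpoly] clash with those of MathComp-Analysis, hence the
   bare names: [mpoly n R] is R[X_0, ..., X_(n-1)], [mderiv i p] the partial
   derivative of p in X_i, [meval x p] the value of p at x, and
   [ishomog1 d mdeg] the polynomials that are homogeneous of degree d (0
   included). *)
From mathcomp Require Export -(notations) mpoly.

Set Implicit Arguments.
Unset Strict Implicit.
Unset Printing Implicit Defensive.

Import Order.TTheory GRing.Theory Num.Theory.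
Import numFieldNormedType.Exports.

Local Open Scope classical_set_scope.
Local Open Scope ring_scope.

Definition dotv (R : realType) (N : nat) (u v : 'cV[R]_N) : R :=
  \sum_i u i 0 * v i 0.

(* The library norm of matrices is the sup norm, so the Euclidean one is
   introduced here. *)
Definition enorm (R : realType) (N : nat) (u : 'cV[R]_N) : R :=
  Num.sqrt (dotv u u).

Section Submanifold.
Variables (R : realType) (N : nat).
Implicit Types (M : set 'cV[R]_N.+1) (x : 'cV[R]_N.+1).

(* Velocities at x of the C^1 curves through x that lie in M; only the germ at
   time 0 of the curve matters. *)
Definition tangent_space M x : set 'cV[R]_N.+1 :=
  [set v | exists c : R -> 'cV[R]_N.+1,
    [/\ c 0 = x,
        \forall t \near (0 : R), M (c t),
        \forall t \near (0 : R), derivable c t 1,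
        \forall t \near (0 : R), {for t, continuous (derive1 c)} &
        derive1 c 0 = v]].

Definition normal_space M x : set 'cV[R]_N.+1 :=
  [set v | forall u, tangent_space M x u -> dotv u v = 0].

Definition normal_tube M (t : R) : set ('cV[R]_N.+1 * 'cV[R]_N.+1) :=
  [set p | [/\ M p.1, normal_space M p.1 p.2 & enorm p.2 < t]].

(* Since the inequality in [normal_tube] is strict, the admissible t form a
   down-closed set containing its finite supremum: the supremum is the largest
   admissible t. It is +oo when all t are admissible. *)
Definition tau M : \bar R :=
  ereal_sup [set t%:E | t in
    [set t : R | set_inj (normal_tube M t) (fun p => p.1 + p.2)]].

End Submanifold.

Section PolynomialSystem.
Variables (R : realType) (m n : nat).
Implicit Types (f : 'I_m -> mpoly n.+1 R) (x : 'cV[R]_n.+1).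

Definition in_Hd (d : 'I_m -> nat) f : Prop :=
  forall i, f i \is ishomog1 (d i) mdeg.

Definition evalsys f x : 'cV[R]_m := \col_i meval (fun j => x j 0) (f i).

Definition MS f : set 'cV[R]_n.+1 :=
  [set x | enorm x = 1 /\ evalsys f x = 0].

Definition Df f x : 'M[R]_(m, n.+1) :=
  \matrix_(i, j) meval (fun l => x l 0) (mderiv j (f i)).

(* Directional derivative of a polynomial along v. *)
Definition dirderiv (v : 'cV[R]_n.+1) (p : mpoly n.+1 R) : mpoly n.+1 R :=
  \sum_j v j 0 *: mderiv j p.

(* D^k f(x)(v_1, ..., v_k); derivations along constant vectors commute, so the
   order of iteration is irrelevant. *)
Definition Dk f x (k : nat) (v : k.-tuple 'cV[R]_n.+1) : 'cV[R]_m :=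
  \col_i meval (fun l => x l 0) (foldr dirderiv (f i) v).

Definition pinv (A : 'M[R]_(m, n.+1)) : 'M[R]_(n.+1, m) :=
  A^T *m invmx (A *m A^T).

Definition opnorm (k : nat)
    (phi : k.-tuple 'cV[R]_n.+1 -> 'cV[R]_n.+1) : R :=
  sup [set enorm (phi v) | v in
    [set v : k.-tuple 'cV[R]_n.+1 | forall i, enorm (tnth v i) <= 1]].

(* D^k f = 0 as soon as k exceeds all the degrees, so this supremum is a
   maximum. *)
Definition gamma f x : R :=
  sup [set (opnorm (fun v : k.-tuple 'cV[R]_n.+1 =>
              pinv (Df f x) *m ((k`!%:R)^-1 *: Dk f x v)))
             `^ ((k.-1)%:R^-1) | k in [set k : nat | (1 < k)%N]].

(* A maximum when Df f x is surjective at every x in MS f: then MS f is compact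
   and gamma f is continuous on it. *)
Definition Gamma f : \bar R :=
  ereal_sup [set (Num.max 1 (gamma f x))%:E | x in MS f].

End PolynomialSystem.

(* Main.v *)
Require Import Defs.
From HB Require Import structures.
From mathcomp Require Import all_boot all_order all_algebra.
From mathcomp Require Import all_classical all_reals all_analysis.
From mathcomp Require Import ring lra.

Set Implicit Arguments.
Unset Strict Implicit.
Unset Printing Implicit Defensive.

Import Order.TTheory GRing.Theory Num.Theory.
Import numFieldNormedType.Exports.

Local Open Scope classical_set_scope.
Local Open Scope ring_scope.

Local Notation pinv := Defs.pinv.
Local Notation normal_space := Defs.normal_space.
Local Notation dirderivs := (foldr (@dirderiv _ _)).

(** Suppose [x + v = y + w] with [x], [y] on the manifold M and [v], [w] normal
    at [x], [y], both shorter than [t], and put [u = y - x = v - w], so that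
    [|u| ^ 2 = <u, v> - <u, w>].  A chord of M is tangent up to a quadratic
    error: [|<u, v>| <= 5/2 * Gamma * |u| ^ 2 * |v|], and likewise for [w]
    ([chord_normal_bound]).  Hence [|u| ^ 2 <= 5 * Gamma * t * |u| ^ 2], and for
    [t = 1 / (87 Gamma)] this forces [u = 0] ([normal_tube_inj]).

    The chord bound has two ingredients.  First, a normal vector [v] at [x] is
    the sum of its projections on [x] and on the row space of [Df f x], with
    projector [P = pinv (Df f x) *m Df f x], since the tangent space contains
    the kernel of [Df f x] in the hyperplane orthogonal to [x]; thus
    [|<u, v>| <= |v| (|<u, x>| + |P u|)] ([dotv_decomposition]).  Second, both
    terms are quadratic in [u].  Comparing [|y| = |x| = 1] gives
    [<u, x> = - |u| ^ 2 / 2].  In the Taylor expansion of [f] at [x] the values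
    [f x] and [f (x + u)] vanish, so [P u] is minus the sum of the terms of
    order [k >= 2], each at most [gamma ^ (k - 1) * |u| ^ k]; this geometric sum
    is at most [2 * gamma * |u| ^ 2] as soon as [gamma * |u| <= 1/2]
    ([quadratic_estimate]).

    That the tangent space, defined by velocities of C^1 curves, is as large as
    claimed is an implicit function theorem ([ker_sub_tangent_space]).  It is
    proved from a difference quotient: a polynomial map satisfies
    [F y - F x = H (x, y) *m (y - x)] with [H] continuous and
    [H (x, x) = DF (x)].  Banach's fixed point theorem yields, for each small
    [t], a zero [c t] of [F] in [x0 + t w + (row space)], and the same identity
    read on two such zeros gives [c t' - c t = (t' - t) *: K (c t, c t')] with
    [K] continuous and [K (x0, x0) = w]: continuity, differentiability and
    continuity of the derivative of [c] all follow from this one formula. *)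

(** * Euclidean geometry of column vectors *)

Section Euclid.
Variables (R : realType) (N : nat).
Implicit Types (u v w : 'cV[R]_N) (a : R).

Lemma dotvE u v : dotv u v = (u^T *m v) 0 0.
Proof. by rewrite mxE; apply: eq_bigr => i _; rewrite mxE. Qed.

Lemma dotvC u v : dotv u v = dotv v u.
Proof. by apply: eq_bigr => i _; rewrite mulrC. Qed.

Lemma dotvDl u v w : dotv (u + v) w = dotv u w + dotv v w.
Proof. by rewrite -big_split; apply: eq_bigr => i _; rewrite mxE mulrDl. Qed.

Lemma dotvZl a u v : dotv (a *: u) v = a * dotv u v.
Proof. by rewrite mulr_sumr; apply: eq_bigr => i _; rewrite mxE mulrA. Qed.

Lemma dotvNl u v : dotv (- u) v = - dotv u v.
Proof. by rewrite -scaleN1r dotvZl mulN1r. Qed.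

Lemma dotvBl u v w : dotv (u - v) w = dotv u w - dotv v w.
Proof. by rewrite dotvDl dotvNl. Qed.

Lemma dotvDr u v w : dotv u (v + w) = dotv u v + dotv u w.
Proof. by rewrite dotvC dotvDl !(dotvC _ u). Qed.

Lemma dotvZr a u v : dotv u (a *: v) = a * dotv u v.
Proof. by rewrite dotvC dotvZl dotvC. Qed.

Lemma dotvNr u v : dotv u (- v) = - dotv u v.
Proof. by rewrite dotvC dotvNl dotvC. Qed.

Lemma dotvBr u v w : dotv u (v - w) = dotv u v - dotv u w.
Proof. by rewrite dotvDr dotvNr. Qed.

Lemma dotv_ge0 u : 0 <= dotv u u.
Proof. by apply: sumr_ge0 => i _; rewrite -expr2 sqr_ge0. Qed.

Lemma dotv_eq0 u : dotv u u = 0 -> u = 0.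
Proof.
move=> /eqP; rewrite psumr_eq0 => [/allP u0|i _]; last first.
  by rewrite -expr2 sqr_ge0.
apply/colP => i; rewrite mxE; apply/eqP.
by have := u0 i (mem_index_enum i); rewrite -expr2 sqrf_eq0.
Qed.

Lemma enorm_ge0 u : 0 <= enorm u.
Proof. exact: sqrtr_ge0. Qed.

Lemma sqr_enorm u : enorm u ^+ 2 = dotv u u.
Proof. by rewrite sqr_sqrtr// dotv_ge0. Qed.

Lemma enorm_eq0 u : enorm u = 0 -> u = 0.
Proof. by move=> u0; apply: dotv_eq0; rewrite -sqr_enorm u0 expr0n. Qed.

Lemma enorm0 : enorm (0 : 'cV[R]_N) = 0.
Proof. by rewrite /enorm -(scale0r 0) dotvZl mul0r sqrtr0. Qed.

Lemma enormZ a u : enorm (a *: u) = `|a| * enorm u.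
Proof.
by rewrite /enorm dotvZl dotvZr mulrA -expr2 sqrtrM ?sqr_ge0// sqrtr_sqr.
Qed.

Lemma enormN u : enorm (- u) = enorm u.
Proof. by rewrite -scaleN1r enormZ normrN normr1 mul1r. Qed.

Lemma Cauchy_Schwarz u v : `|dotv u v| <= enorm u * enorm v.
Proof.
have [v0|v0] := eqVneq (dotv v v) 0.
  rewrite (dotv_eq0 v0) (_ : dotv u 0 = 0) ?normr0 ?mulr_ge0 ?enorm_ge0//.
  by rewrite -(scale0r 0) dotvZr mul0r.
rewrite -[leLHS]normr_id -[leRHS]ger0_norm ?mulr_ge0 ?enorm_ge0//.
rewrite -ler_sqr ?nnegrE// !real_normK ?num_real// exprMn !sqr_enorm.
have := dotv_ge0 (dotv v v *: u - dotv u v *: v).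
rewrite dotvBl !dotvBr !dotvZl !dotvZr (dotvC v u) => H.
have vv : 0 < dotv v v by rewrite lt_neqAle eq_sym v0 dotv_ge0.
rewrite -subr_ge0 -(pmulr_rge0 _ vv); apply: le_trans H _.
by rewrite le_eqVlt; apply/orP; left; apply/eqP; ring.
Qed.

Lemma enormD u v : enorm (u + v) <= enorm u + enorm v.
Proof.
rewrite -ler_sqr ?nnegrE ?addr_ge0 ?enorm_ge0// sqr_enorm sqrrD !sqr_enorm.
rewrite dotvDl !dotvDr (dotvC v u).
have := le_trans (ler_norm _) (Cauchy_Schwarz u v); lra.
Qed.

Lemma enorm_sum (I : Type) (r : seq I) (P : pred I) (F : I -> 'cV[R]_N) :
  enorm (\sum_(i <- r | P i) F i) <= \sum_(i <- r | P i) enorm (F i).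
Proof.
elim/big_ind2 : _ => // [|a u b v au bv]; first by rewrite enorm0.
exact: le_trans (enormD _ _) (lerD au bv).
Qed.

Lemma enorm_le_l1 u : enorm u <= \sum_i `|u i 0|.
Proof.
have s0 : 0 <= \sum_i `|u i 0| by exact: sumr_ge0.
rewrite -ler_sqr ?nnegrE ?enorm_ge0// sqr_enorm expr2 mulr_suml.
apply: ler_sum => i _; rewrite (le_trans (ler_norm _))// normrM ler_wpM2l//.
by rewrite (bigD1 i)//= lerDl sumr_ge0.
Qed.

Lemma coord_le_enorm u i : `|u i 0| <= enorm u.
Proof.
rewrite -[leLHS]normr_id -[leRHS]ger0_norm ?enorm_ge0//.
rewrite -ler_sqr ?nnegrE// !real_normK ?num_real// sqr_enorm /dotv (bigD1 i)//=.
by rewrite -expr2 lerDl sumr_ge0// => j _; rewrite -expr2 sqr_ge0.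
Qed.

End Euclid.

Lemma dotv_mulmx (R : realType) (N k : nat) (A : 'M[R]_(k, N)) u v :
  dotv (A *m u) v = dotv u (A^T *m v).
Proof. by rewrite !dotvE trmx_mul mulmxA. Qed.

(** * Polynomials along lines *)

Section Polynomials.
Variables (R : realType) (N : nat).
Implicit Types (p q : mpoly N R) (x u v : 'cV[R]_N).

(** The induction principle for properties that behave well under products, such
    as identities between derivations or between ring morphisms. *)
Lemma mpoly_ringind (P : mpoly N R -> Prop) :
  (forall c, P (mpolyC N c)) -> (forall i, P (mpolyX R (mnm1 i))) ->
  (forall p q, P p -> P q -> P (p + q)) ->
  (forall p q, P p -> P q -> P (p * q)) -> forall p, P p.
Proof.
move=> PC PX PD PM; elim/mpolyind => [|c k p _ _ Pp].
  by rewrite -[0]/(mpolyC N 0).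
apply: PD => //; rewrite -mul_mpolyC; apply: (PM) => //.
rewrite mpolyXE_id; elim/big_ind : _ => //; first exact: (PC 1).
move=> i _; elim: (k i) => [|e IH]; first by rewrite expr0; exact: (PC 1).
by rewrite exprS; exact: PM.
Qed.

End Polynomials.

Section Directional.
Variables (R : realType) (n : nat).
Implicit Types (p q : mpoly n.+1 R) (x u v : 'cV[R]_n.+1)
  (vs : seq 'cV[R]_n.+1).

Lemma dirderivD v p q : dirderiv v (p + q) = dirderiv v p + dirderiv v q.
Proof.
by rewrite -big_split; apply: eq_bigr => j _; rewrite mderivD scalerDr.
Qed.

Lemma dirderivZr v c p : dirderiv v (c *: p) = c *: dirderiv v p.
Proof.
by rewrite scaler_sumr; apply: eq_bigr => j _; rewrite mderivZ !scalerA mulrC.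
Qed.

Lemma dirderivZl c v p : dirderiv (c *: v) p = c *: dirderiv v p.
Proof.
by rewrite scaler_sumr; apply: eq_bigr => j _; rewrite mxE scalerA.
Qed.

Lemma dirderiv0 v : dirderiv v 0 = 0.
Proof. by have := dirderivZr v 0 0; rewrite !scale0r. Qed.

Lemma dirderiv_sum v (I : Type) (r : seq I) (F : I -> mpoly n.+1 R) :
  dirderiv v (\sum_(i <- r) F i) = \sum_(i <- r) dirderiv v (F i).
Proof. exact: (big_morph _ (dirderivD v) (dirderiv0 v)). Qed.

Lemma dirderivM v p q :
  dirderiv v (p * q) = dirderiv v p * q + p * dirderiv v q.
Proof.
rewrite mulr_suml mulr_sumr -big_split; apply: eq_bigr => j _ /=.
by rewrite mderivM scalerDr scalerAl scalerAr.
Qed.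

Lemma dirderivC v c : dirderiv v (mpolyC n.+1 c) = 0.
Proof. by apply: big1 => j _; rewrite mderivC scaler0. Qed.

Lemma dirderivXU v i : dirderiv v (mpolyX R (mnm1 i)) = mpolyC n.+1 (v i 0).
Proof.
rewrite /dirderiv (bigD1 i)//= big1 => [|j ji]; rewrite mderivX mnm1E.
  rewrite eqxx scale1r addr0 (_ : mnm_sub _ _ = mnm0) ?mpolyX0 ?alg_mpolyC//.
  by apply/mnmP => k; rewrite mnmBE subnn mnm0E.
by rewrite eq_sym (negbTE ji) scale0r scaler0.
Qed.

Lemma foldr_dirderivD vs p q :
  dirderivs (p + q) vs = dirderivs p vs + dirderivs q vs.
Proof. by elim: vs => //= v vs ->; rewrite dirderivD. Qed.

Lemma foldr_dirderivZ vs c p :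
  dirderivs (c *: p) vs = c *: dirderivs p vs.
Proof. by elim: vs => //= v vs ->; rewrite dirderivZr. Qed.

Lemma foldr_dirderiv0 vs : dirderivs 0 vs = 0.
Proof. by elim: vs => //= v vs ->; rewrite dirderiv0. Qed.

Lemma foldr_dirderiv_sum vs (I : Type) (r : seq I) (F : I -> mpoly n.+1 R) :
  dirderivs (\sum_(i <- r) F i) vs =
  \sum_(i <- r) dirderivs (F i) vs.
Proof. by elim: vs => //= v vs ->; rewrite dirderiv_sum. Qed.

Lemma foldr_dirderiv_nseqZ k c v p :
  dirderivs p (nseq k (c *: v)) =
  c ^+ k *: dirderivs p (nseq k v).
Proof.
elim: k => [|k IH] /=; first by rewrite scale1r.
by rewrite IH dirderivZr dirderivZl scalerA -exprSr.
Qed.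

(** Each derivation lowers the degree of a monomial.  So only finitely many [Dk]
    are nonzero, and the supremum defining [gamma] is finite. *)
Lemma foldr_dirderiv_eq0 p :
  exists D, forall vs, (D < size vs)%N -> dirderivs p vs = 0.
Proof.
have mono vs : forall a, (mdeg a < size vs)%N ->
    dirderivs (mpolyX R a) vs = 0.
  elim/last_ind: vs => [|vs v IH] a //; rewrite size_rcons ltnS => ha.
  rewrite foldr_rcons foldr_dirderiv_sum big1// => j _.
  rewrite mderivX scalerA foldr_dirderivZ.
  have [->|aj] := posnP (a j); first by rewrite mulr0 scale0r.
  have ja : mpoly.lem (mnm1 j) a.
    by apply/mnm_lepP => i; rewrite mnm1E; case: eqP => // <-.
  rewrite IH ?scaler0//; apply: leq_trans ha.
  by rewrite -(submK ja) mdegD mdeg1 addn1 submK.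
elim/mpolyind: p => [|c a p _ _ [D hD]].
  by exists 0 => vs _; exact: foldr_dirderiv0.
exists (maxn (mdeg a) D) => vs; rewrite gtn_max => /andP[ha hp].
by rewrite foldr_dirderivD foldr_dirderivZ mono// hD// scaler0 addr0.
Qed.

(** [Dk] is multilinear: expanding the innermost vector in coordinates, which
    are at most 1, bounds a derivative of order [k + 1] by derivatives of order
    [k] of the partial derivatives.  So the suprema defining [opnorm] are
    finite. *)
Lemma foldr_dirderiv_bounded x k p : exists C : R, forall vs,
  size vs = k -> all (fun v => enorm v <= 1) vs ->
  `|meval (fun l => x l 0) (dirderivs p vs)| <= C.
Proof.
elim: k p => [|k IH] p.
  by exists `|meval (fun l => x l 0) p| => -[].
have /choice [C hC] := fun j => IH (mderiv j p).
exists (\sum_j C j) => vs; case/lastP: vs => [|vs v]//.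
rewrite size_rcons => -[hvs]; rewrite all_rcons => /andP[hv hs].
rewrite foldr_rcons foldr_dirderiv_sum raddf_sum/=.
apply: (le_trans (ler_norm_sum _ _ _)); apply: ler_sum => j _.
rewrite foldr_dirderivZ mevalZ normrM -[leRHS]mul1r ler_pM//; last exact: hC.
exact: le_trans (coord_le_enorm _ _) hv.
Qed.

(** Restricting to the line [x + t u] turns [dirderiv u] into the derivative of
    univariate polynomials, from which the Taylor formula is transferred. *)
Definition online x u p : {poly R} :=
  mmap (@polyC R) (fun j => (x j 0)%:P + u j 0 *: 'X) p.

Lemma onlineD x u p q : online x u (p + q) = online x u p + online x u q.
Proof. exact: mmapD. Qed.

Lemma onlineM x u p q : online x u (p * q) = online x u p * online x u q.
Proof. exact: (mmap_is_multiplicative _ _).1. Qed.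

Lemma onlineC x u c : online x u (mpolyC n.+1 c) = c%:P.
Proof. exact: mmapC. Qed.

Lemma onlineX x u i :
  online x u (mpolyX R (mnm1 i)) = (x i 0)%:P + u i 0 *: 'X.
Proof. by rewrite /online mmapX mmap1U. Qed.

Lemma horner_online x u p t :
  (online x u p).[t] = meval (fun j => (x + t *: u) j 0) p.
Proof.
elim/mpoly_ringind: p => [c|i|p q IHp IHq|p q IHp IHq].
- by rewrite onlineC hornerC mevalC.
- by rewrite onlineX mevalXU !hornerE !mxE mulrC.
- by rewrite onlineD hornerD mevalD IHp IHq.
- by rewrite onlineM hornerM mevalM IHp IHq.
Qed.

Lemma deriv_online x u p : (online x u p)^`() = online x u (dirderiv u p).
Proof.
elim/mpoly_ringind: p => [c|i|p q IHp IHq|p q IHp IHq].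
- by rewrite dirderivC onlineC derivC; exact: (esym (mmap0 _ _)).
- rewrite dirderivXU onlineC onlineX derivD derivC derivZ derivX add0r.
  by rewrite alg_polyC.
- by rewrite dirderivD !onlineD derivD IHp IHq.
- by rewrite dirderivM onlineD !onlineM derivM IHp IHq.
Qed.

Lemma derivn_online x u p k :
  (online x u p)^`(k) = online x u (dirderivs p (nseq k u)).
Proof. by elim: k => [|k IH]; rewrite ?derivn0 ?derivnS ?IH ?deriv_online. Qed.

Lemma meval_dirderiv x u p :
  meval (fun l => x l 0) (dirderiv u p) = (online x u p)^`().[0].
Proof. by rewrite deriv_online horner_online scale0r addr0. Qed.

Lemma mpoly_Taylor x u p :
  exists D, forall K, (D <= K)%N ->
    meval (fun l => (x + u) l 0) p =
    \sum_(k < K) (k`!%:R)^-1 *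
      meval (fun l => x l 0) (dirderivs p (nseq k u)).
Proof.
exists (size (online x u p)) => K DK.
have -> : meval (fun l => (x + u) l 0) p = (online x u p).[0 + 1].
  by rewrite horner_online add0r scale1r.
rewrite (nderiv_taylor_wide _ DK); last exact: commr1.
apply: eq_bigr => k _; rewrite expr1n mulr1.
have := congr1 (fun r => r.[0]) (nderivn_def k (online x u p)).
rewrite derivn_online horner_online scale0r addr0 => ->.
by rewrite hornerMn -[X in _ = _ * X]mulr_natl mulKf// pnatr_eq0 -lt0n fact_gt0.
Qed.

Lemma meval_homog d p x c : p \is ishomog1 d mdeg ->
  meval (fun l => (c *: x) l 0) p = c ^+ d * meval (fun l => x l 0) p.
Proof.
move=> /dhomogP hp; rewrite !mevalE mulr_sumr !big_seq.
apply: eq_bigr => a /hp /= <-; rewrite mulrCA; congr (_ * _).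
rewrite mdegE -prodrXr -big_split; apply: eq_bigr => i _.
by rewrite mxE exprMn.
Qed.

(** A homogeneous polynomial vanishing at [x] vanishes on the whole line through
    [x] and the origin, so its derivative along [x] is zero. *)
Lemma Euler_root d p x : p \is ishomog1 d mdeg ->
  meval (fun l => x l 0) p = 0 -> meval (fun l => x l 0) (dirderiv x p) = 0.
Proof.
move=> hp p0; rewrite meval_dirderiv.
suff -> : online x x p = 0 by rewrite derivC hornerC.
apply/eqP/negPn/negP => nz.
(* The restriction to the line has more roots than its degree allows. *)
pose roots := [seq i%:R : R | i <- iota 0 (size (online x x p))].
have := @max_poly_roots R (online x x p) roots nz.
rewrite size_map size_iota ltnn => H; apply/Bool.diff_false_true/H.
  apply/allP => _ /mapP[i _ ->]; rewrite /root horner_online.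
  have -> : x + i%:R *: x = (1 + i%:R) *: x by rewrite scalerDl scale1r.
  by rewrite (meval_homog _ _ hp) p0 mulr0.
by rewrite map_inj_uniq ?iota_uniq//; move=> i j /eqP; rewrite eqr_nat => /eqP.
Qed.

End Directional.

(** * Surjective matrices and the orthogonal projection onto the row space *)

Lemma mulmx_trmx_eq0 (R : realType) (k N : nat) (M : 'M[R]_(k, N)) :
  M *m M^T = 0 -> M = 0.
Proof.
move=> M0; apply/matrixP => i j; rewrite mxE.
have : (M *m M^T) i i = 0 by rewrite M0 mxE.
rewrite mxE => /eqP; rewrite psumr_eq0 => [/allP/(_ j (mem_index_enum _))|l _].
  by rewrite mxE -expr2 sqrf_eq0 => /eqP.
by rewrite mxE -expr2 sqr_ge0.
Qed.

(** If [r *m A *m A^T = 0] then [r *m A] has norm zero, and a right inverse of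
    [A] gives [r = 0]. *)
Lemma surj_gram_unit (R : realType) (k N : nat) (A : 'M[R]_(k, N)) :
  (forall y : 'cV[R]_k, exists v, A *m v = y) -> A *m A^T \in unitmx.
Proof.
move=> surj; pose B := A *m A^T.
have /choice[V AV] := fun j => surj (col j 1%:M).
have AW : A *m (\matrix_(i, j) V j i 0) = 1%:M.
  apply/matrixP => i j; have /colP/(_ i) := AV j; rewrite !mxE => <-.
  by apply: eq_bigr => l _; rewrite mxE.
rewrite -row_free_unit -kermx_eq0; apply/eqP.
rewrite -[kermx _]mulmx1 -AW mulmxA (_ : kermx _ *m A = 0) ?mul0mx//.
apply: mulmx_trmx_eq0.
by rewrite trmx_mul !mulmxA -(mulmxA _ A) mulmx_ker mul0mx.
Qed.

Section PseudoInverse.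
Variables (R : realType) (m n : nat) (A : 'M[R]_(m, n.+1)).
Hypothesis Au : A *m A^T \in unitmx.
Implicit Types (u v x : 'cV[R]_n.+1).

Lemma mulmx_pinv_mul : A *m (pinv A *m A) = A.
Proof. by rewrite /pinv !mulmxA mulmxV// mul1mx. Qed.

Lemma trmx_pinv_mul : (pinv A *m A)^T = pinv A *m A.
Proof. by rewrite /pinv !trmx_mul trmxK trmx_inv trmx_mul trmxK mulmxA. Qed.

(** The remainder [w] after removing from [v] its projections on [x] and on the
    row space of [A] lies in [ker A] and is orthogonal to [x]; it is therefore
    orthogonal to [v], and to both projections, hence to itself. *)
Lemma orthogonal_decomposition x v : A *m x = 0 -> dotv x x = 1 ->
  (forall w, A *m w = 0 -> dotv x w = 0 -> dotv w v = 0) ->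
  v = dotv v x *: x + (pinv A *m A) *m v.
Proof.
move=> Ax xx hv; set P := pinv A *m A.
have Px : P *m x = 0 by rewrite -mulmxA Ax mulmx0.
have dP a b : dotv (P *m a) b = dotv a (P *m b).
  by rewrite dotv_mulmx trmx_pinv_mul.
pose w := v - dotv v x *: x - P *m v.
have Aw : A *m w = 0.
  by rewrite !mulmxBr -scalemxAr Ax scaler0 subr0 mulmxA mulmx_pinv_mul subrr.
have dot0 : dotv v 0 = 0 by have := dotvZr 0 v v; rewrite scale0r mul0r.
have xw : dotv x w = 0.
  by rewrite dotvC !dotvBl dotvZl xx mulr1 subrr dP Px dot0 subr0.
have Pw : P *m w = 0 by rewrite -mulmxA Aw mulmx0.
have wv := hv w Aw xw.
suff /dotv_eq0/eqP : dotv w w = 0.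
  by rewrite subr_eq0 subr_eq => /eqP {1}->; rewrite addrC.
rewrite {2}/w !dotvBr wv dotvZr (dotvC w x) xw -dP Pw (dotvC 0) dot0.
by rewrite mulr0 !subr0.
Qed.

Lemma dotv_decomposition u v x : A *m x = 0 -> dotv x x = 1 ->
  (forall w, A *m w = 0 -> dotv x w = 0 -> dotv w v = 0) ->
  `|dotv u v| <= enorm v * (`|dotv u x| + enorm ((pinv A *m A) *m u)).
Proof.
move=> Ax xx hv; rewrite [in leLHS](orthogonal_decomposition Ax xx hv).
rewrite dotvDr dotvZr -[X in _ + X]dotvC dotv_mulmx trmx_pinv_mul mulrDr.
rewrite (le_trans (ler_normD _ _))// lerD ?Cauchy_Schwarz//.
rewrite normrM ler_wpM2r// (le_trans (Cauchy_Schwarz _ _))//.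
by rewrite [enorm x]/enorm xx sqrtr1 mulr1.
Qed.

End PseudoInverse.

(** * The quadratic estimate *)

Section Quadratic.
Variables (R : realType) (m n : nat) (f : 'I_m -> mpoly n.+1 R).
Implicit Types (x u : 'cV[R]_n.+1).

(** The [k]-linear maps whose operator norms define [gamma]. *)
Definition taylor_term x k (v : k.-tuple 'cV[R]_n.+1) : 'cV[R]_n.+1 :=
  pinv (Df f x) *m ((k`!%:R)^-1 *: Dk f x v).

Lemma taylor_term_bounded x k : has_ubound [set enorm (taylor_term x v) | v in
  [set v : k.-tuple 'cV[R]_n.+1 | forall i, enorm (tnth v i) <= 1]].
Proof.
have /choice[C hC] := fun i => foldr_dirderiv_bounded x k (f i).
exists (\sum_i \sum_j `|pinv (Df f x) i j| * (`|(k`!%:R)^-1| * C j)).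
move=> _ [v hv <-]; rewrite (le_trans (enorm_le_l1 _))// ler_sum// => i _.
rewrite mxE (le_trans (ler_norm_sum _ _ _))// ler_sum// => j _.
rewrite normrM ler_wpM2l// !mxE normrM ler_wpM2l//.
by apply: hC; [exact: size_tuple|apply/all_tnthP].
Qed.

Lemma opnorm_ge0 x k : 0 <= opnorm (@taylor_term x k).
Proof.
apply: le_trans (enorm_ge0 (taylor_term x [tuple of nseq k 0])) _.
apply: ub_le_sup; first exact: taylor_term_bounded.
by eexists; last reflexivity; move=> i /=; rewrite tnth_nseq enorm0.
Qed.

Lemma Dk_nseqZ x k c u : Dk f x [tuple of nseq k (c *: u)] =
  c ^+ k *: Dk f x [tuple of nseq k u].
Proof.
by apply/colP => i; rewrite !mxE /= foldr_dirderiv_nseqZ mevalZ.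
Qed.

(** The operator norm is a supremum over the unit ball, so the general case is
    reached by rescaling [u]. *)
Lemma taylor_term_diag_le x k u :
  enorm (taylor_term x [tuple of nseq k u]) <=
  opnorm (@taylor_term x k) * enorm u ^+ k.
Proof.
have [->|u0] := eqVneq u 0.
  case: k => [|k].
    rewrite expr0 mulr1; apply: ub_le_sup; first exact: taylor_term_bounded.
    by eexists; last reflexivity; move=> [].
  rewrite enorm0 expr0n mulr0 (_ : taylor_term _ _ = 0) ?enorm0//.
  have := Dk_nseqZ x k.+1 0 0.
  by rewrite scale0r expr0n scale0r /taylor_term => ->; rewrite scaler0 mulmx0.
have nu : 0 < enorm u.
  rewrite lt_neqAle enorm_ge0 andbT eq_sym; apply: contra u0 => /eqP /enorm_eq0.
  by move=> ->.
pose w := (enorm u)^-1 *: u.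
have uw : u = enorm u *: w by rewrite scalerA mulfV ?gt_eqF// scale1r.
have -> : taylor_term x [tuple of nseq k u] =
    enorm u ^+ k *: taylor_term x [tuple of nseq k w].
  rewrite /taylor_term scalemxAr; congr (_ *m _).
  by rewrite scalerA mulrC -scalerA -Dk_nseqZ -uw.
rewrite enormZ mulrC ger0_norm ?exprn_ge0 ?enorm_ge0// ler_wpM2r//.
  by rewrite exprn_ge0 ?enorm_ge0.
apply: ub_le_sup; first exact: taylor_term_bounded.
eexists; last reflexivity; move=> i /=.
rewrite tnth_nseq enormZ ger0_norm ?invr_ge0 ?enorm_ge0//.
by rewrite mulVf ?gt_eqF.
Qed.

Lemma Dk_eq0 x : exists K, forall k (v : k.-tuple 'cV[R]_n.+1),
  (K < k)%N -> Dk f x v = 0.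
Proof.
have /choice[D hD] := fun i => foldr_dirderiv_eq0 (f i).
exists (\max_i D i) => k v Kk; apply/colP => i; rewrite !mxE hD ?meval0//.
by rewrite size_tuple (leq_ltn_trans _ Kk)// leq_bigmax.
Qed.

Lemma opnorm_le_gamma x k : (1 < k)%N ->
  opnorm (@taylor_term x k) `^ (k.-1%:R^-1) <= gamma f x.
Proof.
move=> k1; apply: ub_le_sup; last by exists k.
have [K hK] := Dk_eq0 x.
exists (\sum_(k < K.+1) opnorm (@taylor_term x k) `^ (k.-1%:R^-1)).
move=> _ [j j1 <-]; have [jK|Kj] := leqP j K.
  rewrite -/(taylor_term _) (bigD1 (Ordinal (jK : (j < K.+1)%N)))//= lerDl.
  by apply: sumr_ge0 => *; exact: powR_ge0.
have -> : opnorm (@taylor_term x j) = 0.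
  rewrite /opnorm (_ : [set _ | _ in _] = [set 0]) ?sup1//.
  have t0 v : enorm (@taylor_term x j v) = 0.
    by rewrite /taylor_term hK// scaler0 mulmx0 enorm0.
  apply/seteqP; split => [_ [v _ <-] /=|_ ->]; first exact: t0.
  by exists [tuple of nseq j 0] => // i; rewrite tnth_nseq enorm0.
rewrite powR0 ?sumr_ge0// => [*|]; first exact: powR_ge0.
by rewrite invr_neq0// pnatr_eq0; case: j j1 {Kj} => [|[|]].
Qed.

Lemma opnorm_le_exp x k g : gamma f x <= g ->
  opnorm (@taylor_term x k.+2) <= g ^+ k.+1.
Proof.
move=> hg; have h := le_trans (opnorm_le_gamma x (isT : (1 < k.+2)%N)) hg.
have g0 : 0 <= g := le_trans (powR_ge0 _ _) h.
have {}h := lerXn2r k.+1 (powR_ge0 _ _ : _ \is Num.nneg) g0 h.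
apply: le_trans h; rewrite -powR_mulrn ?powR_ge0// -powRrM mulVf ?pnatr_eq0//.
by rewrite powRr1// opnorm_ge0.
Qed.

Lemma evalsys_Taylor x u : exists D, forall K, (D <= K)%N ->
  evalsys f (x + u) =
  \sum_(k < K) (k`!%:R)^-1 *: Dk f x [tuple of nseq k u].
Proof.
have /choice[D hD] := fun i => mpoly_Taylor x u (f i).
exists (\max_i D i) => K DK; apply/colP => i; rewrite mxE summxE (hD i K).
  by apply: eq_bigr => k _; rewrite !mxE.
by apply: leq_trans DK; exact: leq_bigmax.
Qed.

Lemma Df_mul x u :
  Df f x *m u = \col_i meval (fun l => x l 0) (dirderiv u (f i)).
Proof.
apply/colP => i; rewrite !mxE raddf_sum/=; apply: eq_bigr => j _.
by rewrite mxE mevalZ mulrC.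
Qed.

Lemma geometric_le2 (q : R) k : 0 <= q -> q <= 2^-1 -> \sum_(i < k) q ^+ i <= 2.
Proof.
move=> q0 q1; have := subrX1 q k; set S := \sum_(_ < _) _ => E.
have S0 : 0 <= S by apply: sumr_ge0 => *; exact: exprn_ge0.
have qk : 0 <= q ^+ k by exact: exprn_ge0.
have : (1 - q) * S <= 1 by rewrite -opprB mulNr -E; lra.
by apply: contraTT; rewrite -!ltNge; nra.
Qed.

(** Since [f] vanishes at [x] and [x + u], the Taylor expansion expresses the
    first-order term by the terms of order at least two, whose sum is dominated
    by a geometric series of ratio [g * enorm u]. *)
Lemma quadratic_estimate x u g :
  evalsys f x = 0 -> evalsys f (x + u) = 0 -> gamma f x <= g -> 0 <= g ->
  g * enorm u <= 2^-1 ->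
  enorm ((pinv (Df f x) *m Df f x) *m u) <= 2 * g * enorm u ^+ 2.
Proof.
move=> fx fxu hg g0 gu; have [D /(_ D.+2)] := evalsys_Taylor x u.
rewrite fxu => /(_ (leq_trans (leqnSn _) (leqnSn _)))/esym.
rewrite big_ord_recl big_ord_recl /= (_ : Dk f x _ = 0); last first.
  by apply/colP => i; move/colP/(_ i): fx; rewrite !mxE.
rewrite scaler0 add0r invr1 scale1r.
have -> : Dk f x [tuple of nseq 1 u] = Df f x *m u.
  by rewrite Df_mul; apply/colP => i; rewrite !mxE.
move=> /eqP; rewrite addr_eq0 => /eqP/(congr1 (mulmx (pinv (Df f x)))).
rewrite mulmxA => ->; rewrite mulmxN enormN mulmx_sumr.
apply: (le_trans (enorm_sum _ _ _)).
have -> : 2 * g * enorm u ^+ 2 = g * enorm u ^+ 2 * 2 by ring.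
have h0 : 0 <= g * enorm u ^+ 2 by rewrite mulr_ge0 ?sqr_ge0.
apply: le_trans (ler_wpM2l h0 (geometric_le2 D (mulr_ge0 g0 (enorm_ge0 u)) gu)).
rewrite mulr_sumr; apply: ler_sum => i _.
apply: (le_trans (taylor_term_diag_le _ _ _)).
have -> : g * enorm u ^+ 2 * (g * enorm u) ^+ i = g ^+ i.+1 * enorm u ^+ i.+2.
  by rewrite !exprS exprMn; ring.
by rewrite ler_wpM2r ?exprn_ge0 ?enorm_ge0// opnorm_le_exp.
Qed.

End Quadratic.

(** * Limits and norms of matrices *)

(** This joins the completeness and the norm of matrix spaces, as Banach's fixed
    point theorem requires. *)
HB.instance Definition _ (R : realType) (m n : nat) := Complete.on 'M[R]_(m, n).

Section MatrixLimits.
Variables (R : realType) (T : Type) (G : set_system T).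
Context {FG : Filter G}.

Lemma cvg_mx m n (M : T -> 'M[R]_(m, n)) (L : 'M[R]_(m, n)) :
  (forall i j, M t i j @[t --> G] --> L i j) -> M t @[t --> G] --> L.
Proof.
move=> hM; apply/cvgrPdist_le => e e0; near=> t.
rewrite /Num.Def.normr/= mx_normrE (bigmax_le _ (ltW e0))//= => i _.
rewrite !mxE; move: i; near: t; apply: filter_forall => /= i.
exact: ((cvgrPdist_le _ _).1 (hM i.1 i.2) e e0).
Unshelve. all: by end_near. Qed.

Lemma cvg_coord m n (M : T -> 'M[R]_(m, n)) (L : 'M[R]_(m, n)) i j :
  M t @[t --> G] --> L -> M t i j @[t --> G] --> L i j.
Proof.
move=> ML; apply: (@cvg_comp _ _ _ M (fun A : 'M[R]_(m, n) => A i j) _ _ _ ML).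
exact: coord_continuous.
Qed.

Lemma cvg_mulmx m n p (M : T -> 'M[R]_(m, n)) (P : T -> 'M[R]_(n, p))
    (L : 'M[R]_(m, n)) (Q : 'M[R]_(n, p)) :
  M t @[t --> G] --> L -> P t @[t --> G] --> Q ->
  M t *m P t @[t --> G] --> L *m Q.
Proof.
move=> ML PQ; apply: cvg_mx => i j; rewrite mxE.
under eq_fun do rewrite mxE.
by apply: (cvg_big add_continuous) => l _; apply: cvgM; exact: cvg_coord.
Qed.

Lemma cvg_det n (M : T -> 'M[R]_n) (L : 'M[R]_n) :
  M t @[t --> G] --> L -> \det (M t) @[t --> G] --> \det L.
Proof.
move=> ML; apply: (cvg_big add_continuous) => s _.
apply: cvgM; first exact: cvg_cst.
by apply: (cvg_big mul_continuous) => i _; exact: cvg_coord.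
Qed.

Lemma cvg_adj n (M : T -> 'M[R]_n) (L : 'M[R]_n) :
  M t @[t --> G] --> L -> \adj (M t) @[t --> G] --> \adj L.
Proof.
move=> ML; apply: cvg_mx => i j; rewrite mxE; under eq_fun do rewrite mxE.
apply: cvgM; first exact: cvg_cst.
apply: cvg_det; apply: cvg_mx => a b; rewrite !mxE.
by under eq_fun do rewrite !mxE; exact: cvg_coord.
Qed.

Lemma near_unitmx n (M : T -> 'M[R]_n) (L : 'M[R]_n) : L \in unitmx ->
  M t @[t --> G] --> L -> \forall t \near G, M t \in unitmx.
Proof.
rewrite unitmxE unitfE => L0 /cvg_det/cvgr_neq0/(_ L0).
by apply: filterS => t; rewrite unitmxE unitfE.
Qed.

Lemma cvg_invmx n (M : T -> 'M[R]_n) (L : 'M[R]_n) : L \in unitmx ->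
  M t @[t --> G] --> L -> invmx (M t) @[t --> G] --> invmx L.
Proof.
move=> Lu ML; rewrite {2}/invmx Lu.
have : (\det (M t))^-1 *: \adj (M t) @[t --> G] --> (\det L)^-1 *: \adj L.
  apply: cvgZ; last exact: cvg_adj.
  by apply: cvgV; [rewrite -unitfE -unitmxE|exact: cvg_det].
apply: cvg_trans; apply: near_eq_cvg.
by move: (near_unitmx Lu ML); apply: filterS => t Mu; rewrite /invmx Mu.
Qed.

End MatrixLimits.

Section MatrixNorm.
Variable R : realType.

Lemma mx_norm_le m n (M : 'M[R]_(m, n)) c :
  0 <= c -> (forall i j, `|M i j| <= c) -> `|M| <= c.
Proof.
move=> c0 hM; rewrite /Num.Def.normr/= mx_normrE.
by apply: bigmax_le => // i _; exact: hM.
Qed.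

Lemma coord_le_mx_norm m n (M : 'M[R]_(m, n)) i j : `|M i j| <= `|M|.
Proof.
rewrite [leRHS]/Num.Def.normr/= mx_normrE.
exact: (le_bigmax _ (fun ij : 'I_m * 'I_n => `|M ij.1 ij.2|) (i, j)).
Qed.

Lemma mx_norm_mulmx m n p (M : 'M[R]_(m, n)) (P : 'M[R]_(n, p)) :
  `|M *m P| <= n%:R * `|M| * `|P|.
Proof.
apply: mx_norm_le => [|i j]; first by rewrite !mulr_ge0.
rewrite mxE (le_trans (ler_norm_sum _ _ _))//.
rewrite -mulrA mulr_natl -[X in _ *+ X]card_ord -sumr_const.
by apply: ler_sum => l _; rewrite normrM ler_pM// coord_le_mx_norm.
Qed.

End MatrixNorm.

(** * Tangent vectors of a regular zero set *)

Section ImplicitFunction.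
Variables (R : realType) (n k : nat).
Variables (F : 'cV[R]_n.+1 -> 'cV[R]_k).
Variables (H : 'cV[R]_n.+1 * 'cV[R]_n.+1 -> 'M[R]_(k, n.+1)).
Hypothesis HF : forall x y, F y - F x = H (x, y) *m (y - x).
Hypothesis Hcont : continuous H.
Variables (x0 w : 'cV[R]_n.+1).
Hypothesis Fx0 : F x0 = 0.
Let A := H (x0, x0).
Hypothesis Au : A *m A^T \in unitmx.
Hypothesis Aw : A *m w = 0.

Let B := A *m A^T.
(* [G] is the matrix of the linear equation satisfied by the difference of two
   zeros in [x0 + R w + (row space)], and [K] the resulting velocity. *)
Let G p := H p *m A^T.
Let K p := w - A^T *m (invmx (G p) *m (H p *m w)).

Let cvgH p : H q @[q --> p] --> H p. Proof. exact: Hcont. Qed.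

Let cvgG p : G q @[q --> p] --> G p.
Proof. by apply: cvg_mulmx; [exact: cvgH|exact: cvg_cst]. Qed.

Let cvgK p : G p \in unitmx -> K q @[q --> p] --> K p.
Proof.
move=> Gu; apply: cvgB; first exact: cvg_cst.
apply: cvg_mulmx; first exact: cvg_cst.
apply: cvg_mulmx; first exact: (cvg_invmx Gu (@cvgG p)).
by apply: cvg_mulmx; [exact: cvgH|exact: cvg_cst].
Qed.

Let K0 : K (x0, x0) = w.
Proof. by rewrite /K Aw !mulmx0 subr0. Qed.

(** What the construction of the curve asks of a pair of points close to [x0]:
    the equation for the difference of two zeros is solvable, the simplified
    Newton map is a contraction of ratio 1/2, the curve is Lipschitz, and the
    Newton map moves the centre of the slice by at most [|t|].  The factor [k]
    is the one of [mx_norm_mulmx]. *)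
Definition good_pair p := [/\ G p \in unitmx,
  k%:R * `|1%:M - invmx B *m G p| <= 2^-1, `|K p| <= `|w| + 1 &
  `|invmx B *m (H p *m w)| <= 1].

Lemma good_radius : exists2 rho : R, 0 < rho & forall x y,
  `|x - x0| < rho -> `|y - x0| < rho -> good_pair (x, y).
Proof.
have : \forall p \near (x0, x0), good_pair p.
  have h1 := near_unitmx Au (@cvgG (x0, x0)).
  have h2 : \forall p \near (x0, x0), k%:R * `|1%:M - invmx B *m G p| <= 2^-1.
    have : 1%:M - invmx B *m G q @[q --> (x0, x0)] --> (0 : 'M[R]_k).
      rewrite -[X in _ --> X](subrr (1%:M : 'M[R]_k)).
      rewrite -[X in _ --> _ - X](mulVmx Au); apply: cvgB; first exact: cvg_cst.
      by apply: cvg_mulmx; [exact: cvg_cst|exact: cvgG].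
    have e0 : `|0 : 'M[R]_k| < (2 * k.+1%:R)^-1.
      by rewrite normr0 invr_gt0 mulr_gt0.
    move=> /cvgr_norm_lt/(_ _ e0); apply: filterS => p hp.
    rewrite (le_trans (ler_wpM2l _ (ltW hp)))// invfM mulrCA ler_piMr//.
    by rewrite ler_pdivrMr// mul1r ler_nat.
  have h3 : \forall p \near (x0, x0), `|K p| <= `|w| + 1.
    have /cvgr_norm_le := cvgK (Au : G (x0, x0) \in unitmx).
    by apply; rewrite K0 ltrDl.
  have h4 : \forall p \near (x0, x0), `|invmx B *m (H p *m w)| <= 1.
    have : invmx B *m (H q *m w) @[q --> (x0, x0)] --> invmx B *m (A *m w).
      apply: cvg_mulmx; first exact: cvg_cst.
      by apply: cvg_mulmx; [exact: cvgH|exact: cvg_cst].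
    by move=> /cvgr_norm_le; apply; rewrite Aw mulmx0 normr0.
  near=> p; split.
  - by near: p; exact: h1.
  - by near: p; exact: h2.
  - by near: p; exact: h3.
  - by near: p; exact: h4.
move=> /nbhs_ballP[rho rho0 hrho]; exists rho => // x y hx hy.
by apply: hrho; split; rewrite -ball_normE /= distrC.
Unshelve. all: by end_near. Qed.

(** On the slice through [x0 + t w] parallel to the row space of [A] there are as
    many unknowns [s] as equations. *)
Definition slice_sol rho t z :=
  [/\ exists s, z = x0 + t *: w + A^T *m s, F z = 0 & `|z - x0| < rho].

Section Radius.
Variable rho : R.
Hypothesis rho_good : forall x y,
  `|x - x0| < rho -> `|y - x0| < rho -> good_pair (x, y).

(** Applying the difference quotient to two zeros gives a linear equation for the
    difference of their coordinates [s], which [G] inverts. *)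
Lemma slice_sol_sub t t' z z' : slice_sol rho t z -> slice_sol rho t' z' ->
  z' - z = (t' - t) *: K (z, z').
Proof.
move=> [[s zs] Fz hz] [[s' zs'] Fz' hz'].
have [Gu _ _ _] := rho_good hz hz'.
have [ds zz] : exists ds, z' - z = (t' - t) *: w + A^T *m ds.
  exists (s' - s); rewrite zs zs' mulmxBr scalerBl.
  by apply/colP => i; rewrite !mxE; ring.
have := HF z z'; rewrite Fz Fz' subrr zz mulmxDr mulmxA -scalemxAr => /esym/eqP.
rewrite addrC addr_eq0 => /eqP/(congr1 (mulmx (invmx (G (z, z'))))).
rewrite mulKmx// => ->.
by rewrite /K scalerBr mulmxN -scalemxAr mulmxN -scalemxAr.
Qed.

(** The zeros on a slice are the fixed points of the simplified Newton map
    [s - B^-1 *m F (x0 + t w + A^T *m s)].  On a ball of radius [r] it is a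
    contraction, and for small [t] it maps that ball to itself because [A w = 0]
    makes its value at 0 small. *)
Lemma slice_sol_ex : 0 < rho -> exists2 eta : R, 0 < eta &
  forall t, `|t| < eta -> exists z, slice_sol rho t z.
Proof.
move=> rho0.
(* With this radius [A^T *m s] stays within [rho / 2]; the bounds on [t] keep
   [t w] within [rho / 2] and the image of 0 within [r / 2]. *)
pose r := rho / (2 * (k%:R * `|A^T| + 1)).
have c0 : 0 < k%:R * `|A^T| + 1 by rewrite ltr_wpDl// mulr_ge0.
have r0 : 0 < r by rewrite divr_gt0// mulr_gt0.
have hr : k%:R * `|A^T| * r <= rho / 2.
  rewrite /r mulrA ler_pdivrMr ?mulr_gt0// mulrA divfK ?pnatr_eq0//.
  by rewrite mulrC ler_wpM2l ?ltW// ltrDl.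
exists (Num.min (r / 2) (rho / (2 * (`|w| + 1)))).
  by rewrite lt_min !divr_gt0// mulr_gt0// ltr_wpDl.
move=> t; rewrite lt_min => /andP[tr trho].
have tw : `|t *: w| < rho / 2.
  rewrite normrZ; have [->|w0] := eqVneq `|w| 0.
    by rewrite mulr0 divr_gt0.
  apply: (@lt_le_trans _ _ (rho / (2 * (`|w| + 1)) * `|w|)).
    by rewrite ltr_pM2r// lt_neqAle eq_sym w0 normr_ge0.
  rewrite mulrAC ler_pdivrMr ?mulr_gt0 ?ltr_wpDl// mulrA divfK ?pnatr_eq0//.
  by rewrite ler_wpM2l ?ltW// ltrDl.
pose z s := x0 + t *: w + A^T *m s.
have zrho s : `|s| <= r -> `|z s - x0| < rho.
  move=> sr; have -> : z s - x0 = t *: w + A^T *m s.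
    by rewrite /z; apply/colP => i; rewrite !mxE; ring.
  rewrite [rho]splitr.
  apply: (le_lt_trans (ler_normD _ _)); rewrite ltr_leD//.
  rewrite (le_trans (mx_norm_mulmx _ _))// (le_trans _ hr)//.
  by rewrite ler_wpM2l// mulr_ge0.
pose g s := s - invmx B *m F (z s).
pose U := [set s : 'cV[R]_k | `|s| <= r].
have contr s s' : U s -> U s' -> `|g s' - g s| <= 2^-1 * `|s' - s|.
  move=> Us Us'; have [_ hG _ _] := rho_good (zrho _ Us) (zrho _ Us').
  have -> : g s' - g s = (1%:M - invmx B *m G (z s, z s')) *m (s' - s).
    have zz : z s' - z s = A^T *m (s' - s).
      by rewrite mulmxBr /z; apply/colP => i; rewrite !mxE; ring.
    rewrite mulmxBl mul1mx /G -!mulmxA -zz -HF mulmxBr /g.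
    by apply/colP => i; rewrite !mxE; ring.
  by rewrite (le_trans (mx_norm_mulmx _ _))// ler_wpM2r.
have U0 : U 0 by rewrite /U /= normr0 ltW.
have g0 : `|g 0| <= r / 2.
  have [_ _ _ h] : good_pair (x0, z 0).
    by apply: rho_good; [rewrite subrr normr0|exact: zrho].
  have -> : g 0 = - (t *: (invmx B *m (H (x0, z 0) *m w))).
    have z0 : z 0 - x0 = t *: w by rewrite /z mulmx0 addr0 addrAC subrr add0r.
    have := HF x0 (z 0); rewrite Fx0 subr0 z0 => Fz0.
    by rewrite /g sub0r Fz0 -!scalemxAr.
  rewrite normrN normrZ (le_trans (ler_wpM2l _ h))// mulr1 ltW//.
have gU : {homo g : s / U s >-> U s}.
  move=> s Us; rewrite /U /= -[g s](subrK (g 0)) (le_trans (ler_normD _ _))//.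
  rewrite [r]splitr lerD// (le_trans (contr _ _ U0 Us))// subr0 mulrC.
  by rewrite ler_wpM2r.
have h2 : 0 <= 2^-1 :> R by [].
have [s Us gs] : exists2 s, U s & s = mkfun gU s.
  apply: banach_fixed_point; last by exists 0.
    exists (NngNum h2); split => /=; first by rewrite invf_lt1// ltr1n.
    by move=> [a b] [Ua Ub]; exact: contr.
  have -> : U = closed_ball_ Num.Def.normr 0 r.
    by apply/seteqP; split=> a; rewrite /U /closed_ball_ /= sub0r normrN.
  exact: closed_closed_ball_.
exists (z s); split; [by exists s| |exact: zrho].
have gs' : g s = s by exact: esym gs.
have X0 : invmx B *m F (z s) = 0 by rewrite -[LHS](subKr s) -/(g s) gs' subrr.
by rewrite -[LHS](mulKVmx Au) X0 mulmx0.
Qed.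

End Radius.

(** Choosing a zero on each slice gives a curve [c] with
    [c u - c t = (u - t) *: K (c t, c u)].  As [K] is bounded near [(x0, x0)],
    [c] is continuous; then the quotients converge to [K (c t, c t)], which is
    continuous in [t] and equals [w] at [t = 0]. *)
Lemma ker_sub_tangent_space : tangent_space [set x | F x = 0] x0 w.
Proof.
have [rho rho0 hrho] := good_radius.
have [eta eta0 /= hsol] := slice_sol_ex hrho rho0.
have /choice[c hc] : forall t : R, exists z, `|t| < eta -> slice_sol rho t z.
  move=> t; have [/hsol[z hz]|_] := ltP `|t| eta; first by exists z.
  by exists 0.
have near_eta (t : R) : `|t| < eta -> \forall u \near (t : R), `|u| < eta.
  move=> ht; have ho : open [set u : R | `|u| < eta].
    have -> : [set u : R | `|u| < eta] = ball 0 eta.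
      by apply/seteqP; split=> a; rewrite -ball_normE /= sub0r normrN.
    exact: ball_open.
  exact: (open_nbhs_nbhs (conj ho ht)).
have csub (t u : R) : `|t| < eta -> `|u| < eta ->
    c u - c t = (u - t) *: K (c t, c u).
  by move=> /hc ht /hc hu; exact: slice_sol_sub hrho _ _ _ _ ht hu.
have cgood (t u : R) : `|t| < eta -> `|u| < eta -> good_pair (c t, c u).
  by move=> /hc[_ _ ht] /hc[_ _ hu]; exact: hrho.
have c_cont (t : R) : `|t| < eta -> c u @[u --> t] --> c t.
  move=> ht; apply/cvgrPdist_le => e e0.
  have hd : 0 < e / (`|w| + 1) by rewrite divr_gt0// ltr_wpDl.
  near=> u.
  have hu : `|u| < eta by near: u; exact: near_eta.
  rewrite distrC csub// normrZ; have [_ _ hK _] := cgood t u ht hu.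
  rewrite (le_trans (ler_wpM2l _ hK))// -ler_pdivlMr; last by rewrite ltr_wpDl.
  rewrite distrC; near: u.
  exact: ((cvgrPdist_le _ _).1 (@cvg_id R (nbhs t)) _ hd).
have K_cont (t : R) : `|t| < eta -> K (c t, c u) @[u --> t] --> K (c t, c t).
  move=> ht; have [Gu _ _ _] := cgood t t ht ht.
  apply: (@cvg_comp _ _ _ (fun u => (c t, c u)) K _ _ _ _ (cvgK Gu)).
  exact: (cvg_pair (cvg_cst (c t)) (c_cont t ht)).
have quot (t : R) : `|t| < eta ->
    h^-1 *: ((c \o shift t) (h *: 1) - c t) @[h --> 0^'] --> K (c t, c t).
  move=> ht.
  have shift_cvg : h + t @[h --> (0 : R)^'] --> t.
    have : h + t @[h --> (0 : R)] --> t.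
      by rewrite -{2}[t]add0r; apply: cvgD; [exact: cvg_id|exact: cvg_cst].
    by apply: cvg_trans; apply: cvg_app; exact: nbhs_dnbhs.
  have := @cvg_comp _ _ _ _ (fun u => K (c t, c u)) _ _ _
    shift_cvg (K_cont t ht).
  apply: cvg_trans; apply: near_eq_cvg; near=> h.
  have h0 : h != 0 by near: h; exact: nbhs_dnbhs_neq.
  have hht : `|h + t| < eta by near: h; exact: (shift_cvg _ (near_eta t ht)).
  rewrite /= -[h *: 1]/(h * 1) mulr1 csub//.
  by rewrite addrK scalerA mulVf// scale1r.
have deriv (t : R) : `|t| < eta -> derive1 c t = K (c t, c t).
  move=> ht; rewrite derive1E; apply: cvg_lim => //; exact: quot.
have c0 : c 0 = x0.
  have z0 : `|0 : R| < eta by rewrite normr0.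
  have s0 : slice_sol rho 0 x0.
    split=> //; last by rewrite subrr normr0.
    by exists 0; rewrite scale0r mulmx0 !addr0.
  have /eqP := slice_sol_sub hrho s0 (hc 0 z0).
  by rewrite subrr scale0r subr_eq0 => /eqP.
have n0 : \forall t \near (0 : R), `|t| < eta.
  by apply: near_eta; rewrite normr0.
exists c; split => //.
- by apply: filterS n0 => t /hc[].
- apply: filterS n0 => t ht; apply/cvg_ex; exists (K (c t, c t)).
  exact: quot.
- apply: filterS n0 => t ht; have [Gu _ _ _] := cgood t t ht ht.
  change (derive1 c u @[u --> t] --> derive1 c t); rewrite deriv//.
  have : K (c u, c u) @[u --> t] --> K (c t, c t).
    apply: (@cvg_comp _ _ _ (fun u => (c u, c u)) K _ _ _ _ (cvgK Gu)).
    exact: (cvg_pair (c_cont t ht) (c_cont t ht)).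
  apply: cvg_trans; apply: near_eq_cvg.
  by apply: filterS (near_eta t ht) => u hu; rewrite deriv.
- by rewrite deriv ?normr0// c0 K0.
Unshelve. all: by end_near. Qed.

End ImplicitFunction.

(** * Difference quotients of polynomials *)

Lemma continuous_meval (R : realType) (N : nat) (p : mpoly N R) :
  continuous (fun x : 'cV[R]_N => meval (fun l => x l 0) p).
Proof.
have : forall x : 'cV[R]_N, meval (fun l => y l 0) p @[y --> x] -->
    meval (fun l => x l 0) p.
  elim/mpoly_ringind: p => [c|i|p q hp hq|p q hp hq] x.
  - by rewrite mevalC; under eq_fun do rewrite mevalC; exact: cvg_cst.
  - rewrite mevalXU; under eq_fun do rewrite mevalXU.
    exact: (@coord_continuous R N 1 i 0 x).
  - rewrite mevalD; under eq_fun do rewrite mevalD.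
    by apply: cvgD; [exact: hp|exact: hq].
  - rewrite mevalM; under eq_fun do rewrite mevalM.
    by apply: cvgM; [exact: hp|exact: hq].
by [].
Qed.

(** For a product, [p y * q y - p x * q x] is split as
    [(p y - p x) * q y + p x * (q y - q x)]. *)
Lemma polynomial_difference_quotient (R : realType) (N : nat) (p : mpoly N R) :
  exists h : 'I_N -> 'cV[R]_N * 'cV[R]_N -> R,
  [/\ forall j, continuous (h j),
      forall x y : 'cV[R]_N,
        meval (fun l => y l 0) p - meval (fun l => x l 0) p =
        \sum_j h j (x, y) * (y j 0 - x j 0) &
      forall x j, h j (x, x) = meval (fun l => x l 0) (mderiv j p)].
Proof.
elim/mpoly_ringind: p => [c|i|p q|p q].
- exists (fun _ _ => 0); split=> [j x|x y|x j]; first exact: cvg_cst.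
    by rewrite !mevalC subrr big1// => j _; rewrite mul0r.
  by rewrite mderivC meval0.
- exists (fun j _ => (j == i)%:R); split=> [j x|x y|x j]; first exact: cvg_cst.
    rewrite !mevalXU (bigD1 i)//= eqxx mul1r big1 ?addr0// => j /negbTE ->.
    by rewrite mul0r.
  rewrite mderivX mevalZ mnm1E eq_sym; have [->|ji] := eqVneq j i.
    rewrite (_ : mnm_sub _ _ = mnm0) ?mpolyX0 ?meval1 ?mulr1//.
    by apply/mnmP => l; rewrite mnmBE subnn mnm0E.
  by rewrite mul0r.
- move=> [h [hc he hd]] [k [kc ke kd]].
  exists (fun j z => h j z + k j z); split=> [j z|x y|x j].
  + by apply: cvgD; [exact: hc|exact: kc].
  + rewrite !mevalD opprD addrACA he ke -big_split.
    by apply: eq_bigr => j _; rewrite mulrDl.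
  + by rewrite mderivD mevalD hd kd.
- move=> [h [hc he hd]] [k [kc ke kd]].
  exists (fun j z => h j z * meval (fun l => z.2 l 0) q +
                     meval (fun l => z.1 l 0) p * k j z); split=> [j z|x y|x j].
  + apply: cvgD; apply: cvgM; [exact: hc| | |exact: kc].
      apply: (@cvg_comp _ _ _ snd
        (fun x : 'cV[R]_N => meval (fun l => x l 0) q)).
        exact: cvg_snd.
      exact: continuous_meval.
    apply: (@cvg_comp _ _ _ fst (fun x : 'cV[R]_N => meval (fun l => x l 0) p)).
      exact: cvg_fst.
    exact: continuous_meval.
  + rewrite /= (eq_bigr (fun j => h j (x, y) * (y j 0 - x j 0) *
        meval (fun l => y l 0) q + meval (fun l => x l 0) p *
        (k j (x, y) * (y j 0 - x j 0)))) => [|j _]; last by ring.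
    rewrite big_split/= -mulr_suml -mulr_sumr -he -ke !mevalM.
    by rewrite mulrBl mulrBr addrA subrK.
  + by rewrite mderivM mevalD !mevalM hd kd.
Qed.

(** * Normal vectors of the spherical zero set *)

Section NormalVectors.
Variables (R : realType) (m n : nat) (f : 'I_m -> mpoly n.+1 R).
Implicit Types (x y u v w : 'cV[R]_n.+1).

(** The sphere is treated as one more equation, with difference quotient
    [(x + y)^T]. *)
Definition sphere_system x : 'cV[R]_(m + 1) :=
  col_mx (evalsys f x) (const_mx (dotv x x - 1)).

Lemma MS_sphere_system : MS f = [set x | sphere_system x = 0].
Proof.
apply/seteqP; split=> x; rewrite /MS /sphere_system /= -(@col_mx0 _ m 1 1).
  move=> [nx ->]; congr col_mx; apply/colP => i.
  by rewrite !mxE -sqr_enorm nx expr1n subrr.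
move=> /eq_col_mx[-> /colP/(_ 0)]; rewrite !mxE => /eqP; rewrite subr_eq0.
by rewrite /enorm => /eqP ->; rewrite sqrtr1.
Qed.

(** As [Df f x] kills [x], the gradient of the sphere equation is independent of
    those of [f], so that the extended system is regular at [x]. *)
Lemma tangent_space_MS x w : MS f x ->
  (forall y : 'cV[R]_m, exists v, Df f x *m v = y) -> Df f x *m x = 0 ->
  Df f x *m w = 0 -> dotv x w = 0 -> tangent_space (MS f) x w.
Proof.
move=> Mx surj Dx Dw xw.
have xx : dotv x x = 1 by rewrite -sqr_enorm Mx.1 expr1n.
have /choice[h hP] := fun i => polynomial_difference_quotient (f i).
pose H (p : 'cV[R]_n.+1 * 'cV[R]_n.+1) : 'M[R]_(m + 1, n.+1) :=
  col_mx (\matrix_(i, j) h i j p) (p.1 + p.2)^T.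
have HE y z : sphere_system z - sphere_system y = H (y, z) *m (z - y).
  rewrite /sphere_system opp_col_mx add_col_mx mul_col_mx; congr col_mx.
    apply/colP => i; rewrite !mxE; have [_ -> _] := hP i.
    by apply: eq_bigr => j _; rewrite !mxE.
  apply/colP => i; rewrite ord1 -dotvE dotvDl !dotvBr (dotvC z y) !mxE /=.
  by ring.
have Hc : continuous H.
  move=> p; apply: cvg_mx => i j; rewrite mxE; under eq_fun do rewrite mxE.
  case: (fintype.split i) => a; rewrite !mxE; under eq_fun do rewrite !mxE.
    by have [hc _ _] := hP a; exact: hc.
  apply: cvgD.
    apply: (@cvg_comp _ _ _ fst (fun z : 'cV[R]_n.+1 => z j a)).
      exact: cvg_fst.
    exact: coord_continuous.
  apply: (@cvg_comp _ _ _ snd (fun z : 'cV[R]_n.+1 => z j a)).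
    exact: cvg_snd.
  exact: coord_continuous.
have Hx : H (x, x) = col_mx (Df f x) (x + x)^T.
  congr col_mx; apply/matrixP => i j; rewrite !mxE.
  by have [_ _ ->] := hP i.
have Au : H (x, x) *m (H (x, x))^T \in unitmx.
  apply: surj_gram_unit => y; have [v Dv] := surj (usubmx y).
  (* Moving along [x], which [Df f x] kills, adjusts the sphere equation. *)
  pose c : R := (dsubmx y 0 0 - 2 * dotv x v) / 2.
  exists (v + c *: x); rewrite Hx mul_col_mx mulmxDr -scalemxAr Dx scaler0 addr0.
  rewrite Dv -[RHS]vsubmxK; congr col_mx; apply/colP => i; rewrite ord1.
  by rewrite -dotvE dotvDl dotvDr dotvZr xx /c; field.
rewrite MS_sphere_system; apply: (ker_sub_tangent_space HE Hc _ Au).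
  by move: Mx; rewrite MS_sphere_system.
rewrite Hx mul_col_mx Dw -(@col_mx0 _ m 1 1); congr col_mx; apply/colP => i.
by rewrite ord1 -dotvE dotvDl xw addr0 mxE.
Qed.

Hypothesis hsurj : forall x, MS f x ->
  forall y : 'cV[R]_m, exists v : 'cV[R]_n.+1, Df f x *m v = y.
Variable d : 'I_m -> nat.
Hypothesis hf : in_Hd d f.

Lemma Df_mul_self x : MS f x -> Df f x *m x = 0.
Proof.
move=> [_ /colP fx]; apply/colP => i; rewrite Df_mul !mxE.
by apply: (Euler_root (hf i)); have := fx i; rewrite !mxE.
Qed.

(** A chord of the zero set is orthogonal to the normal spaces at its ends up to
    a quadratic error, made of the curvature [enorm u ^+ 2 / 2] of the sphere
    and of the estimate [2 * g * enorm u ^+ 2] for [f]. *)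
Lemma chord_normal_bound x y v g : MS f x -> MS f y ->
  normal_space (MS f) x v -> gamma f x <= g -> 1 <= g ->
  g * enorm (y - x) <= 2^-1 ->
  `|dotv (y - x) v| <= enorm v * (5 / 2 * g * enorm (y - x) ^+ 2).
Proof.
move=> Mx My Nv hg g1; set u := y - x => gu.
have xx : dotv x x = 1 by rewrite -sqr_enorm Mx.1 expr1n.
have yy : dotv y y = 1 by rewrite -sqr_enorm My.1 expr1n.
have yE : y = x + u by rewrite addrC subrK.
clearbody u.
have Dx := Df_mul_self Mx.
have ux : dotv u x = - (enorm u ^+ 2 / 2).
  rewrite sqr_enorm; move: yy; rewrite yE dotvDl !dotvDr xx (dotvC x u) => yy.
  by lra.
have Au := surj_gram_unit (hsurj Mx).
apply: le_trans (dotv_decomposition (v := v) Au u Dx xx _) _.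
  by move=> w Dw xw; apply: Nv; exact: tangent_space_MS (hsurj Mx) Dx Dw xw.
rewrite ler_wpM2l ?enorm_ge0//.
have := quadratic_estimate (f := f) (x := x) (u := u) Mx.2.
rewrite -yE => /(_ _ My.2 hg (le_trans ler01 g1) gu).
have -> : `|dotv u x| = enorm u ^+ 2 / 2.
  by rewrite ux normrN ger0_norm// divr_ge0 ?sqr_ge0.
have := sqr_ge0 (enorm u); nra.
Qed.

Lemma normal_tube_inj (g : R) :
  1 <= g -> (forall x, MS f x -> gamma f x <= g) ->
  set_inj (normal_tube (MS f) (1 / (87 * g))) (fun p => p.1 + p.2).
Proof.
move=> g1 hg [x v] [y w] /set_mem[/= Mx Nv hv] /set_mem[/= My Nw hw] /= E.
have g0 : 0 < g by exact: lt_le_trans ltr01 g1.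
set t := 1 / (87 * g) in hv hw.
have tg : t * g = 1 / 87 by rewrite /t; field; rewrite gt_eqF.
clearbody t.
pose u := y - x.
have uE : u = v - w.
  by apply/eqP; rewrite subr_eq addrAC eq_sym subr_eq [v + x]addrC E.
have u_lt : enorm u <= enorm v + enorm w.
  by rewrite uE (le_trans (enormD _ _))// enormN.
have gu : g * enorm u <= 2^-1.
  apply: (@le_trans _ _ (g * (t + t))).
    rewrite ler_wpM2l ?(ltW g0)// (le_trans u_lt)//.
    by apply: lerD; exact: ltW.
  by rewrite mulrDr mulrC tg; lra.
have hxv := chord_normal_bound Mx My Nv (hg x Mx) g1 gu.
have uN : x - y = - u by rewrite opprB.
have gu' : g * enorm (x - y) <= 2^-1 by rewrite uN enormN.
have hyw := chord_normal_bound My Mx Nw (hg y My) g1 gu'.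
rewrite uN enormN dotvNl normrN in hyw.
have uu : enorm u ^+ 2 = dotv u v - dotv u w.
  by rewrite sqr_enorm {2}uE dotvBr.
have u0 : u = 0.
  apply: enorm_eq0; apply/eqP; rewrite -sqrf_eq0 eq_le sqr_ge0 andbT.
  set D := enorm u ^+ 2 in hxv hyw uu *.
  have h1 := le_trans (ler_norm _) hxv.
  have h2 : - dotv u w <= enorm w * (5 / 2 * g * D).
    by apply: le_trans hyw; rewrite -normrN ler_norm.
  have D0 : 0 <= D by exact: sqr_ge0.
  have h3 : D <= (enorm v + enorm w) * (5 / 2 * g * D) by lra.
  have h4 : (enorm v + enorm w) * (5 / 2 * g * D) <= (t + t) * (5 / 2 * g * D).
    apply: ler_wpM2r; first by rewrite mulr_ge0// mulr_ge0// ltW.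
    by apply: lerD; exact: ltW.
  have h5 : (t + t) * (5 / 2 * g * D) = 5 / 87 * D.
    have -> : (t + t) * (5 / 2 * g * D) = 5 * (t * g) * D by field.
    by rewrite tg; field.
  by lra.
have xy : x = y by apply/eqP; rewrite eq_sym -subr_eq0 -/u u0.
by move: E; rewrite xy => /addrI ->.
Qed.

End NormalVectors.

Theorem theorem2p9 (R : realType) (m n : nat) (hm : (1 <= m)%N)
    (hmn : (m <= n)%N) (d : 'I_m -> nat) (hd : forall i, (2 <= d i)%N)
    (f : 'I_m -> mpoly n.+1 R) (hf : in_Hd d f)
    (hne : MS f !=set0)
    (hsurj : forall x, MS f x ->
      forall y : 'cV[R]_m, exists v : 'cV[R]_n.+1, Df f x *m v = y) :
  (1 / (87%:R%:E * Gamma f) <= tau (MS f))%E.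
Proof.
have hG x : MS f x -> ((Num.max 1 (gamma f x))%:E <= Gamma f)%E.
  by move=> Mx; apply: ereal_sup_ubound; exists x.
(* The tube of radius 0 is empty. *)
have tau0 : (0 <= tau (MS f))%E.
  apply: ereal_sup_ubound; exists 0 => // p q /set_mem[_ _].
  by rewrite ltNge enorm_ge0.
case: hne => x0 Mx0; have := hG x0 Mx0.
case: (Gamma f) hG => [g||] hG //.
  rewrite lee_fin ge_max => /andP[g1 _].
  have hg x : MS f x -> gamma f x <= g.
    by move=> /hG; rewrite lee_fin ge_max => /andP[].
  have g0 : 0 < g by exact: lt_le_trans ltr01 g1.
  rewrite -EFinM inver gt_eqF ?mulr_gt0// -EFinM.
  apply: ereal_sup_ubound; exists (1 / (87 * g)) => //.
  exact: (normal_tube_inj hsurj hf g1 hg).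
(* When [Gamma f] is infinite the lower bound is zero. *)
by rewrite gt0_muley ?lte_fin// invey mule0.
Qed.
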